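(* Let $q\ge 1$ be an integer, let $I=\{(r,s)\,:\,1\le r\le s\le q\}$ and $q^*=|I|=q(q+1)/2$. Let $\mathcal{S}=\{\bm{\alpha}=(\alpha_{rs})_{(r,s)\in I}\in[0,1]^{I} : \sum_{(r,s)\in I}\alpha_{rs}=1\}$ be the regular $(q^*-1)$-dimensional simplex and $\mathcal{C}=[0,1]^{I}$ the $q^*$-dimensional hypercube, whose points are written $\bm{P}=(p_{rs})_{(r,s)\in I}$. Let $T:\mathcal{S}\times\mathcal{C}\to\mathcal{S}\times\mathcal{C}$ be a transformation of the form $T(\bm{\alpha},\bm{P})=(f_1(\bm{\alpha}),f_2(\bm{P}))$, defined at every point of the parameter space, where $f_1$ is a symmetry of $\mathcal{S}$ and $f_2$ is a symmetry of $\mathcal{C}$. (1) Then there are permutations $\pi,\omega$ of $I$ and numbers $\gamma_{rs}\in\{0,1\}$, $(r,s)\in I$, such that $T$ maps $(\bm{\alpha},\bm{P})$ to $(\bm{\alpha}',\bm{P}')$ with $$p_{rs}'=\gamma_{rs}+(1-2\gamma_{rs})\,p_{\omega(r,s)},\qquad \alpha_{rs}'=\alpha_{\pi(r,s)}\qquad\text{for all }(r,s)\in I .$$ (2) If in addition $T$ preserves the average detectability, i.e. $\langle\mathcal{L}(\bm{\alpha}',\bm{P}')\rangle=\langle\mathcal{L}(\bm{\alpha},\bm{P})\rangle$ for all $(\bm{\alpha},\bm{P})\in\mathcal{S}\times\mathcal{C}$, then $\pi=\omega$ and there is $\gamma\in\{0,1\}$ with $\gamma_{rs}=\gamma$ for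 all $(r,s)\in I$.
   Context: For $\bm{\alpha}\in\mathcal{S}$ and $\bm{P}\in\mathcal{C}$, put $\rho=\sum_{(r,s)\in I}\alpha_{rs}p_{rs}$ and define the average detectability (average normalized log-likelihood ratio) by $$\langle\mathcal{L}(\bm{\alpha},\bm{P})\rangle = h(\rho)-\sum_{(r,s)\in I}\alpha_{rs}\,h(p_{rs}),\qquad h(p)=-p\log p-(1-p)\log(1-p),$$ with the convention $0\log 0=0$. A symmetry of a subset $X$ of Euclidean space means a Euclidean isometry of $X$ onto itself; thus the symmetry group of the hypercube $\mathcal{C}$ is the hyperoctahedral group $B_{q^*}$ and that of the regular simplex $\mathcal{S}$ is the symmetric group $S_{q^*}$. The parameters $\bm{\alpha}$ and $\bm{P}$ (the latter a symmetric $q\times q$ matrix, identified with its upper triangle including the diagonal) range over all of $\mathcal{S}$ and $\mathcal{C}$ respectively. *)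

(* Defs.v *)
From mathcomp Require Import all_boot all_order all_algebra perm.
From mathcomp Require Import all_classical all_reals all_analysis.
Set Implicit Arguments.
Unset Strict Implicit.
Unset Printing Implicit Defensive.
Import Order.TTheory GRing.Theory Num.Theory.
Local Open Scope classical_set_scope.
Local Open Scope ring_scope.

(* The index set I of the upper triangle; indices run from 0 to q - 1. *)
Definition idx (q : nat) : finType := {rs : 'I_q * 'I_q | (rs.1 <= rs.2)%N}.

(* The Euclidean space R^I. A symmetric q x q matrix is identified with its
   upper triangle, so it is a point of this space. *)
Notation upper R q := {ffun idx q -> R}.

Definition simplex (R : realType) (q : nat) : set (upper R q) :=
  [set a | (forall rs, 0 <= a rs <= 1) /\ \sum_(rs : idx q) a rs = 1].
Arguments simplex : clear implicits.

Definition cube (R : realType) (q : nat) : set (upper R q) :=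
  [set p | forall rs, 0 <= p rs <= 1].
Arguments cube : clear implicits.

Definition edist (R : realType) (q : nat) (x y : upper R q) : R :=
  Num.sqrt (\sum_(rs : idx q) (x rs - y rs) ^+ 2).

(* Only the restriction of f to X is constrained. *)
Definition is_symmetry (R : realType) (q : nat) (X : set (upper R q))
    (f : upper R q -> upper R q) : Prop :=
  f @` X = X /\ forall x y, X x -> X y -> edist (f x) (f y) = edist x y.

(* ln is total, so 0 * ln 0 = 0 as in the usual convention. *)
Definition entropy (R : realType) (p : R) : R :=
  - (p * ln p) - (1 - p) * ln (1 - p).

Definition detectability (R : realType) (q : nat)
    (aP : upper R q * upper R q) : R :=
  entropy (\sum_(rs : idx q) aP.1 rs * aP.2 rs)
    - \sum_(rs : idx q) aP.1 rs * entropy (aP.2 rs).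

(* The numbers gamma_rs in {0, 1} are encoded as booleans. *)
Definition has_form (R : realType) (q : nat)
    (T : upper R q * upper R q -> upper R q * upper R q)
    (pi omega : {perm idx q}) (gamma : idx q -> bool) : Prop :=
  forall a P, simplex R q a -> cube R q P -> forall rs,
    (T (a, P)).2 rs = (gamma rs)%:R + (1 - 2 * (gamma rs)%:R) * P (omega rs)
    /\ (T (a, P)).1 rs = a (pi rs).

(* Main.v *)
Require Import Defs.
From mathcomp Require Import all_boot all_order all_algebra perm.
From mathcomp Require Import all_classical all_reals all_analysis.
From mathcomp Require Import ring lra.
Local Open Scope classical_set_scope.
Local Open Scope ring_scope.

(* (1) The diameter of the simplex is attained exactly at pairs of distinct
   vertices, and that of the cube exactly at pairs of opposite vertices, so an
   isometry permutes the vertices; the distances to the vertices then determine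
   all coordinates.
   (2) At a 0/1 vertex P the detectability reduces to h(rho), and h vanishes at
   0 and 1 but not at 1/2. For alpha the midpoint of two vertices k and l of the
   simplex, invariance therefore says that if P agrees at k and l, then P'
   agrees at pi^-1 k and pi^-1 l. Taking P = 0 shows that gamma is constant, and
   taking for P the indicator of one index shows that pi = omega. *)

Import Order.TTheory GRing.Theory Num.Theory.

(** * Isometries of the simplex and of the cube over a finite index set *)

Section Isometries.
Context {R : realType} {I : finType}.
Implicit Types (x y : {ffun I -> R}) (f : {ffun I -> R} -> {ffun I -> R}).

Definition sqdist x y : R := \sum_i (x i - y i) ^+ 2.

(** Serves both as a vertex of the simplex and as a corner of the cube adjacent to the origin. *)
Definition vertex (i : I) : {ffun I -> R} := [ffun j => (j == i)%:R].

Definition in_cube x := forall i, 0 <= x i <= 1.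

Definition in_simplex x := in_cube x /\ \sum_i x i = 1.

Lemma sum_vertexM (F : I -> R) i : \sum_j F j * vertex i j = F i.
Proof.
rewrite (bigD1 i) //= ffunE eqxx mulr1 big1 ?addr0 // => j ji.
by rewrite ffunE (negbTE ji) mulr0.
Qed.

Lemma sum_vertex i : \sum_j vertex i j = 1.
Proof. by rewrite -[RHS](sum_vertexM (fun=> 1) i); under [RHS]eq_bigr do rewrite mul1r. Qed.

Lemma vertex_in_cube i : in_cube (vertex i).
Proof. by move=> j; rewrite ffunE; case: eqP => _; rewrite lexx ler01. Qed.

Lemma vertex_in_simplex i : in_simplex (vertex i).
Proof. by split; [exact: vertex_in_cube | exact: sum_vertex]. Qed.

(** Once the norm of [x] is known, its distances to the vertices recover its coordinates. *)
Lemma sqdist_vertex x i :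
  sqdist x (vertex i) = \sum_j x j ^+ 2 + 1 - 2 * x i.
Proof.
rewrite -(sum_vertexM x i) -[X in _ + X - _](sum_vertex i) mulr_sumr -sumrN -!big_split /=.
by apply: eq_bigr => j _; rewrite ffunE; case: eqP => _ /=; ring.
Qed.

Lemma sqdist_vertices i j : i != j -> sqdist (vertex i) (vertex j) = 2.
Proof.
move=> ij; rewrite sqdist_vertex [vertex i j]ffunE eq_sym (negbTE ij).
under eq_bigr do rewrite expr2.
by rewrite sum_vertexM ffunE eqxx /=; ring.
Qed.

Lemma sqdist_xx x : sqdist x x = 0.
Proof. by rewrite /sqdist big1 // => i _; rewrite subrr expr0n. Qed.

Lemma sqdist0r x y : (forall i, y i = 0) -> sqdist x y = \sum_i x i ^+ 2.
Proof. by move=> y0; apply: eq_bigr => i _; rewrite y0 subr0. Qed.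

Lemma binary_sum1 x :
  (forall i, x i = 0 \/ x i = 1) -> \sum_i x i = 1 -> exists i, x = vertex i.
Proof.
move=> x01 sx.
have [i xi|x0] := pickP (fun i => x i != 0); last first.
  by move: sx; rewrite big1 => [/eqP|i _]; rewrite ?(eq_sym 0) ?oner_eq0 //;
     apply/eqP; move: (x0 i) => /negbFE.
have xi1 : x i = 1 by case: (x01 i) xi => -> //; rewrite eqxx.
exists i; apply/ffunP => j; rewrite ffunE; case: eqVneq => [->//|ji].
have x_ge0 k : k != i -> 0 <= x k by case: (x01 k) => ->.
apply: (psumr_eq0P x_ge0) => //.
by move: sx; rewrite (bigD1 i) //= xi1 => sx; lra.
Qed.

(** The terms [x i + y i - (x i - y i) ^+ 2] sum to 0. Each equals x(1 - x) + y(1 - y) + 2xy, which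
    is nonnegative on [0,1], so each summand vanishes. *)
Lemma simplex_diameter x y :
  in_simplex x -> in_simplex y -> sqdist x y = 2 -> exists i, x = vertex i.
Proof.
move=> [x01 sx] [y01 sy] dxy; apply: binary_sum1 => // i.
have s0 : \sum_i (x i + y i - (x i - y i) ^+ 2) = 0.
  by rewrite big_split /= big_split sumrN /= sx sy -/(sqdist x y) dxy; ring.
have s_ge0 j : true -> 0 <= x j + y j - (x j - y j) ^+ 2.
  by move=> _; move: (x01 j) (y01 j) => /andP[? ?] /andP[? ?]; nra.
have {s_ge0 s0} := @psumr_eq0P _ _ _ _ s_ge0 s0 i isT.
move: (x01 i) (y01 i) => /andP[? ?] /andP[? ?] h.
have : x i * (1 - x i) == 0 by apply/eqP; nra.
by rewrite mulf_eq0 subr_eq0 eq_sym => /orP[/eqP <-|/eqP <-]; [left|right].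
Qed.

(** Each of the [#|I|] squared differences is at most 1, so all equal 1, which only opposite
    endpoints of [0,1] achieve. *)
Lemma cube_diameter x y : in_cube x -> in_cube y ->
  sqdist x y = #|I|%:R -> forall i, x i = 0 \/ x i = 1.
Proof.
move=> x01 y01 dxy i.
have s0 : \sum_i (1 - (x i - y i) ^+ 2) = 0.
  by rewrite big_split sumrN /= -/(sqdist x y) dxy sumr_const subrr.
have s_ge0 j : true -> 0 <= 1 - (x j - y j) ^+ 2.
  by move=> _; move: (x01 j) (y01 j) => /andP[? ?] /andP[? ?]; nra.
have {s_ge0 s0} := @psumr_eq0P _ _ _ _ s_ge0 s0 i isT.
move: (x01 i) (y01 i) => /andP[? ?] /andP[? ?] h.
have : x i * (1 - x i) == 0 by apply/eqP; nra.
by rewrite mulf_eq0 subr_eq0 eq_sym => /orP[/eqP <-|/eqP <-]; [left|right].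
Qed.

Lemma simplex_isometry f :
  (forall x, in_simplex x -> in_simplex (f x)) ->
  (forall x y, in_simplex x -> in_simplex y ->
     sqdist (f x) (f y) = sqdist x y) ->
  exists s : {perm I}, forall x, in_simplex x -> forall i, f x i = x (s i).
Proof.
move=> fS fd.
have fv i : exists j, f (vertex i) == vertex j.
  have [j ji|alone] := pickP (fun j => j != i).
    have [|k ->] := simplex_diameter _ _ (fS _ (vertex_in_simplex i))
      (fS _ (vertex_in_simplex j)); last by exists k.
    rewrite fd ?sqdist_vertices 1?eq_sym //; exact: vertex_in_simplex.
  (* Here [i] is the only index and the simplex is a single point. *)
  exists i; apply/eqP/ffunP => j.
  have -> : j = i by apply/eqP; move/negbFE: (alone j).
  have := (fS _ (vertex_in_simplex i)).2.
  rewrite (bigD1 i) //= big_pred0 => [|k]; last exact: alone.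
  by rewrite addr0 => ->; rewrite ffunE eqxx.
pose t i := xchoose (fv i).
have tE i : f (vertex i) = vertex (t i) := eqP (xchooseP (fv i)).
have t_inj : injective t.
  move=> i j tij; apply/eqP; apply: contraT => /sqdist_vertices.
  rewrite -fd ?tE ?tij ?sqdist_xx; try exact: vertex_in_simplex.
  by move=> /eqP; rewrite eq_sym pnatr_eq0.
exists (perm t_inj)^-1%g => x xS i.
have sumfx : \sum_j f x (t j) = 1.
  by rewrite -(fS _ xS).2 [RHS](reindex_inj t_inj).
have diff j : \sum_k f x k ^+ 2 - \sum_k x k ^+ 2 = 2 * (f x (t j) - x j).
  have := fd _ _ xS (vertex_in_simplex j).
  by rewrite tE !sqdist_vertex; lra.
(* Summing [diff] over all vertices cancels the right-hand sides, as both points have coordinate sum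
   1; hence [f] preserves the norm. *)
have diff0 : (\sum_k f x k ^+ 2 - \sum_k x k ^+ 2) *+ #|I| = 0.
  rewrite -sumr_const (eq_bigr _ (fun j _ => diff j)).
  by rewrite -mulr_sumr sumrB sumfx xS.2 subrr mulr0.
have {diff0} diff0 : \sum_k f x k ^+ 2 - \sum_k x k ^+ 2 = 0.
  move/eqP: diff0; rewrite mulrn_eq0 => /orP[|/eqP //].
  by move=> /eqP /card0_eq /(_ i).
have := diff ((perm t_inj)^-1%g i).
by rewrite diff0 -[t _](permE t_inj) permKV; lra.
Qed.

Lemma cube_isometry f :
  (forall x, in_cube x -> in_cube (f x)) ->
  (forall x y, in_cube x -> in_cube y -> sqdist (f x) (f y) = sqdist x y) ->
  exists (s : {perm I}) (c : I -> bool), forall x, in_cube x -> forall i,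
    f x i = (c i)%:R + (1 - 2 * (c i)%:R) * x (s i).
Proof.
move=> fC fd.
(* The corner opposite to [x] lies at squared distance [#|I|], and [f] preserves this distance. *)
have f01 x : in_cube x -> (forall i, x i = 0 \/ x i = 1) ->
    forall i, f x i = 0 \/ f x i = 1.
  move=> xC x01; pose y : {ffun I -> R} := [ffun i => 1 - x i].
  have yC : in_cube y.
    by move=> i; move: (xC i) => /andP[? ?]; rewrite ffunE; apply/andP; split; lra.
  apply: (cube_diameter _ (f y)); try exact: fC.
  rewrite fd // /sqdist -sumr_const; apply: eq_bigr => i _.
  by rewrite ffunE; case: (x01 i) => ->; ring.
pose o : {ffun I -> R} := [ffun=> 0].
have oE i : o i = 0 by rewrite ffunE.
have oC : in_cube o by move=> i; rewrite oE lexx ler01.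
pose c i := f o i == 1.
have foE i : f o i = (c i)%:R.
  rewrite /c; case: (f01 o oC (fun i => or_introl (oE i)) i) => ->.
    by rewrite eq_sym oner_eq0.
  by rewrite eqxx.
(* Composing [f] with the reflections recorded by [c] gives an isometry fixing the origin, hence
   preserving norms. These reflections are involutions, so [f] is recovered from [g] by the same
   formula. *)
pose g x : {ffun I -> R} := [ffun i => (c i)%:R + (1 - 2 * (c i)%:R) * f x i].
have gd x y : in_cube x -> in_cube y -> sqdist (g x) (g y) = sqdist x y.
  move=> xC yC; rewrite -(fd _ _ xC yC); apply: eq_bigr => i _.
  by rewrite !ffunE; case: (c i) => /=; ring.
have go i : g o i = 0 by rewrite ffunE foE; case: (c i) => /=; ring.
have g_norm x : in_cube x -> \sum_i g x i ^+ 2 = \sum_i x i ^+ 2.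
  by move=> xC; rewrite -(sqdist0r _ _ go) -(sqdist0r _ _ oE) gd.
(* The image is binary of squared norm 1, so exactly one coordinate is 1. *)
have gv i : exists j, g (vertex i) == vertex j.
  have g01 j : g (vertex i) j = 0 \/ g (vertex i) j = 1.
    rewrite ffunE; case: (f01 _ (vertex_in_cube i) _ j) => [k|->|->].
    - by rewrite ffunE; case: eqP; [right|left].
    - by case: (c j) => /=; [right|left]; ring.
    - by case: (c j) => /=; [left|right]; ring.
  have [|j ->] := binary_sum1 _ g01; last by exists j.
  have <- : \sum_j vertex i j ^+ 2 = 1.
    by under eq_bigr do rewrite expr2; rewrite sum_vertexM ffunE eqxx.
  rewrite -(g_norm _ (vertex_in_cube i)); apply: eq_bigr => j _.
  by case: (g01 j) => ->; ring.
pose t i := xchoose (gv i).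
have tE i : g (vertex i) = vertex (t i) := eqP (xchooseP (gv i)).
have gt x i : in_cube x -> g x (t i) = x i.
  move=> xC; have := gd _ _ xC (vertex_in_cube i).
  by rewrite tE !sqdist_vertex g_norm //; lra.
have t_inj : injective t.
  move=> i j tij; apply/eqP; rewrite eq_sym.
  have := gt (vertex i) j (vertex_in_cube i).
  rewrite -tij gt ?ffunE ?eqxx; last exact: vertex_in_cube.
  by case: eqP => // _ /eqP; rewrite oner_eq0.
exists (perm t_inj)^-1%g, c => x xC i.
rewrite -(gt x) // -[t _](permE t_inj) permKV ffunE.
by case: (c i) => /=; ring.
Qed.

(** * Midpoints of edges of the simplex *)

Definition midpoint (k l : I) : {ffun I -> R} :=
  [ffun i => (vertex k i + vertex l i) / 2].

Lemma midpoint_in_simplex k l : in_simplex (midpoint k l).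
Proof.
split=> [i|].
  move: (vertex_in_cube k i) (vertex_in_cube l i) => /andP[? ?] /andP[? ?].
  by rewrite ffunE; apply/andP; split; lra.
under eq_bigr do rewrite ffunE.
by rewrite -mulr_suml big_split /= !sum_vertex; field.
Qed.

Lemma sum_midpointM (F : I -> R) k l :
  \sum_i midpoint k l i * F i = (F k + F l) / 2.
Proof.
rewrite -(sum_vertexM F k) -(sum_vertexM F l) -big_split mulr_suml /=.
by apply: eq_bigr => i _; rewrite [midpoint k l i]ffunE; ring.
Qed.

End Isometries.

Lemma symmetry_sqdist (R : realType) (q : nat) (X : set (upper R q)) f :
  is_symmetry X f ->
  (forall x, X x -> X (f x)) /\
  (forall x y, X x -> X y -> sqdist (f x) (f y) = sqdist x y).
Proof.
move=> [fX fd]; split=> [x Xx|x y Xx Xy]; first by rewrite -fX; exists x.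
have ge0 (u v : upper R q) : 0 <= \sum_i (u i - v i) ^+ 2.
  by apply: sumr_ge0 => i _; exact: sqr_ge0.
by apply/eqP; rewrite -eqr_sqrt ?ge0 //; apply/eqP; exact: fd.
Qed.

(** * Detectability at the corners of the cube *)

Lemma entropy_bool (R : realType) (b : bool) : entropy (b%:R : R) = 0.
Proof. by rewrite /entropy; case: b => /=; rewrite ?subrr ?subr0 ?ln1; ring. Qed.

Lemma entropy_half (R : realType) : entropy (2^-1 : R) != 0.
Proof.
have h : ln (2^-1 : R) < 0 by apply: ln_lt0; apply/andP; split; lra.
have e : 1 - 2^-1 = 2^-1 :> R by field.
by apply: lt0r_neq0; rewrite /entropy e; lra.
Qed.

Lemma detectability_vertex (R : realType) (q : nat) (x : upper R q * upper R q)
    (b : idx q -> bool) :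
  (forall i, x.2 i = (b i)%:R) ->
  detectability x = entropy (\sum_i x.1 i * (b i)%:R).
Proof.
move=> x2; rewrite /detectability.
under eq_bigr do rewrite x2.
rewrite [X in _ - X]big1 ?subr0 // => i _.
by rewrite x2 entropy_bool mulr0.
Qed.

(** The number q(q+1)/2 is never 2. For q at most 1 no two indices are distinct; otherwise two
    diagonal corners and one off-diagonal corner of the triangle give three candidates. *)
Lemma idx_third (q : nat) (j k : idx q) : j != k -> exists l, l != j /\ l != k.
Proof.
case: q j k => [|[|q]] j k.
- by case: j => -[[]].
- case: j k => -[r s] p [[r' s'] p'] /eqP[]; apply: val_inj => /=.
  by rewrite !ord1.
move=> _.
pose u : idx q.+2 := exist _ (ord0, ord0) (leqnn 0).
pose v : idx q.+2 := exist _ (ord0, ord_max) (leq0n q.+1).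
pose w : idx q.+2 := exist _ (ord_max, ord_max) (leqnn q.+1).
have uv : u != v by [].
have uw : u != w by [].
have vw : v != w by [].
have [uj|uj] := eqVneq u j; have [uk|uk] := eqVneq u k; last by exists u.
- by exists v; rewrite -uj -uk eq_sym.
- by have [vk|vk] := eqVneq v k; [exists w|exists v];
    rewrite -uj -?vk ![_ == u]eq_sym // [w == v]eq_sym.
- by have [vj|vj] := eqVneq v j; [exists w|exists v];
    rewrite -uk -?vj ![_ == u]eq_sym // [w == v]eq_sym.
Qed.

(** * Consequences of invariance of the detectability *)

Section Invariance.
Context (R : realType) (q : nat).
Context (T : upper R q * upper R q -> upper R q * upper R q).
Context (pi omega : {perm idx q}) (gamma : idx q -> bool).
Context (T_form : has_form T pi omega gamma).
Context (T_inv : forall a P, simplex R q a -> cube R q P ->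
  detectability (T (a, P)) = detectability (a, P)).

Lemma invariance_vertex (b : idx q -> bool) k l : b k = b l ->
  gamma (pi^-1%g k) (+) b (omega (pi^-1%g k)) =
  gamma (pi^-1%g l) (+) b (omega (pi^-1%g l)).
Proof.
move=> bkl; pose P : upper R q := [ffun i => (b i)%:R].
have PC : cube R q P by move=> i; rewrite ffunE; case: (b i); rewrite lexx ler01.
have mS : simplex R q (midpoint k l) := midpoint_in_simplex k l.
pose c i := gamma i (+) b (omega i).
have TP i : (T (midpoint k l, P)).2 i = (c i)%:R.
  rewrite (T_form _ _ mS PC i).1 ffunE /c.
  by case: (gamma i); case: (b _) => /=; ring.
have := T_inv _ _ mS PC.
rewrite (detectability_vertex _ _ _ _ TP).
rewrite (@detectability_vertex _ _ (_, P) b) /=; last by move=> i; rewrite ffunE.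
under eq_bigr do rewrite (T_form _ _ mS PC _).2.
(* Moves [pi] from the weights to the image of [P], so that the weights are again a midpoint. *)
rewrite (reindex_inj (@perm_inj _ pi^-1%g)) /=.
under eq_bigr do rewrite permKV.
rewrite (sum_midpointM (fun i => (c (pi^-1%g i))%:R)).
rewrite (sum_midpointM (fun i => (b i)%:R)) bkl.
have -> : ((b l)%:R + (b l)%:R) / 2 = (b l)%:R :> R by field.
rewrite entropy_bool -/(c _) -/(c (pi^-1%g l)).
(* If the two values differ, the new mean is 1/2, whose entropy is nonzero, while the old entropy is
   0. *)
by case: (c _); case: (c _) => //=; rewrite ?addr0 ?add0r mul1r => /eqP;
  rewrite (negbTE (entropy_half R)).
Qed.

Lemma invariance_gamma i j : gamma i = gamma j.
Proof.
have := invariance_vertex (fun=> false) (pi i) (pi j) erefl.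
by rewrite !permK !addbF.
Qed.

Lemma invariance_perm : pi = omega.
Proof.
apply/permP => i; apply/eqP; apply: contraT => ne.
have [l [lpi lom]] := idx_third _ _ _ ne.
(* The indicator of [omega i] vanishes at both [pi i] and [l]. As [gamma] is constant, invariance
   makes [omega] agree at [i] and at the preimage of [l] under [pi], so [l] would be [pi i]. *)
have := invariance_vertex (fun m => m == omega i) (pi i) l.
rewrite permK eqxx (invariance_gamma (pi^-1%g l) i) (negbTE lom) (negbTE ne).
move=> /(_ erefl) /addbI /esym /eqP /perm_inj e.
by rewrite -e permKV eqxx in lpi.
Qed.

End Invariance.

Theorem theorem1 (R : realType) (q : nat) (hq : (1 <= q)%N)
  (T : upper R q * upper R q -> upper R q * upper R q)
  (f1 f2 : upper R q -> upper R q)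
  (hTfun : set_fun (simplex R q `*` cube R q) (simplex R q `*` cube R q) T)
  (hT : forall a P, simplex R q a -> cube R q P -> T (a, P) = (f1 a, f2 P))
  (hf1 : is_symmetry (simplex R q) f1)
  (hf2 : is_symmetry (cube R q) f2) :
  (exists (pi omega : {perm idx q}) (gamma : idx q -> bool),
     has_form T pi omega gamma)
  /\
  ((forall a P, simplex R q a -> cube R q P ->
      detectability (T (a, P)) = detectability (a, P)) ->
   forall (pi omega : {perm idx q}) (gamma : idx q -> bool),
     has_form T pi omega gamma ->
     pi = omega /\ exists g : bool, forall rs, gamma rs = g).
Proof.
split.
  have [f1S f1d] := symmetry_sqdist _ _ _ _ hf1.
  have [f2C f2d] := symmetry_sqdist _ _ _ _ hf2.
  have [pi piE] := simplex_isometry _ f1S f1d.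
  have [omega [gamma omegaE]] := cube_isometry _ f2C f2d.
  exists pi, omega, gamma => a P aS PC rs.
  by rewrite hT //=; split; [exact: omegaE | exact: piE].
move=> T_inv pi omega gamma T_form; split.
  exact: invariance_perm T_form T_inv.
(* This boolean is the common value of [gamma], obtained without choosing an index. *)
exists [exists rs, gamma rs] => rs; apply/esym.
have [g|/existsPn g] := boolP [exists rs, gamma rs].
  by have [rs' <-] := existsP g; exact: invariance_gamma T_form T_inv _ _.
by apply/esym/negbTE.
Qed.
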